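(* Let $N\ge2$, $1\le M<N$, $\gcd(M,N)=1$, $L\ge3$, $\sigma\in\{+,-\}$, $k\in\mathbb Z_L$, and $\eta\in\mathbb Z_{2N}$. If $\nu_\eta=+1$, where $\nu_\eta=(-1)^{\eta-(1-M)}$ (equivalently, if $\eta\equiv M-1\pmod2$), then for every eigenvalue $\lambda$ of $H_\eta^\sigma(M;k)$ the eigenspace $E_\lambda(H_\eta^\sigma(M;k))$ has even dimension.
   Context: Parameters: $\varepsilon=e^{i\pi/N}$, $q=\varepsilon^M$, $\omega=q^2$, $f_\eta=\varepsilon^\eta$. Endpoint space $\mathbb C^N_a$ with basis $|1\rangle,\dots,|N\rangle$ (indices mod $N$): $Z|n\rangle=\omega^n|n\rangle$, $X|n\rangle=|n+1\rangle$; $Y_{m,n}=X^mZ^n$. A physical site is $\mathbb C^2$ with basis $|0\rangle,|1\rangle$; $\sigma^+=|0\rangle\langle1|$, $\sigma^-=|1\rangle\langle0|$, $\sigma^z=\operatorname{diag}(1,-1)$. Bond density: $h_{j,j+1}=q\sigma_j^+\sigma_{j+1}^-+q^{-1}\sigma_j^-\sigma_{j+1}^++\frac{q+q^{-1}}4\sigma_j^z\sigma_{j+1}^z$. In the two-spin basis $|0\rangle=|00\rangle,|1\rangle=|01\rangle,|2\rangle=|10\rangle,|3\rangle=|11\rangle$ with $E_{rc}=|r\rangle\langle c|$ (tensor signs omitted), operators on $\mathbb C^2_A\otimes\mathbb C^2_B\otimes\mathbb C^N_a$: $$\begin{aligned}S_+=\tfrac12\bigl[&-E_{01}Y_{-1,-1}+q^3E_{02}Y_{-1,0}-q^4E_{03}Y_{-2,-1}-q^2E_{10}Y_{1,1}+q^2E_{12}Y_{0,1}-qE_{13}Y_{-1,0}\\&+q^{-3}E_{20}Y_{1,0}+q^{-2}E_{21}Y_{0,-1}+q^2E_{23}Y_{-1,-1}-E_{30}Y_{2,1}-q^{-1}E_{31}Y_{1,0}+E_{32}Y_{1,1}\bigr],\\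 S_-=\tfrac12\bigl[&E_{01}Y_{-1,1}-qE_{02}Y_{-1,0}-E_{03}Y_{-2,1}+q^{-2}E_{10}Y_{1,-1}+q^2E_{12}Y_{0,-1}+q^3E_{13}Y_{-1,0}\\&-q^{-1}E_{20}Y_{1,0}+q^{-2}E_{21}Y_{0,1}-q^{-2}E_{23}Y_{-1,1}-q^{-4}E_{30}Y_{2,-1}+q^{-3}E_{31}Y_{1,0}-E_{32}Y_{1,-1}\bigr].\end{aligned}$$ Output-normalized seam: $F_+^{(\eta)}=\operatorname{diag}(1,f_\eta)$, $F_-^{(\eta)}=\operatorname{diag}(f_\eta,1)$, $S^{(\eta)}_{\sigma,ABa}=F^{(\eta)}_{\sigma,B}S_{\sigma,ABa}F^{(\eta)\dagger}_{\sigma,B}$ ($F$ on the second physical site $B$). Ring: sites labelled by $\mathbb Z_L$, Hilbert space $(\mathbb C^2)^{\otimes L}\otimes\mathbb C^N_a$, $$H_\eta^\sigma(M;k)=\sum_{j\in\mathbb Z_L,\ j\ne k-1}h_{j,j+1}+S^{(\eta)}_{\sigma,k-1,k,a},$$ subscripts indicating the ordered tensor factors acted on. *)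

(* Defs.v *)
From mathcomp Require Import all_boot all_order all_algebra.
From mathcomp Require Import reals trigo complex mxtens spectral.

Set Implicit Arguments.
Unset Strict Implicit.
Unset Printing Implicit Defensive.

Import GRing.Theory Num.Theory.
Local Open Scope ring_scope.
Local Open Scope complex_scope.
Local Open Scope sesquilinear_scope.

(* An operator A is the matrix A i j = <i|A|j> acting on column vectors, so  *)
(* that products of operators are products *m of matrices in the same order. *)

Definition eps (R : realType) (N : nat) : R[i] :=
  cos (pi / N%:R) +i* sin (pi / N%:R).

Definition qpar (R : realType) (N M : nat) : R[i] := eps R N ^+ M.

Definition omega (R : realType) (N M : nat) : R[i] := qpar R N M ^+ 2.

(* Since eps has order 2N, the class of eta may be replaced by its           *)
(* representative in [0, 2N).                                                *)
Definition fpar (R : realType) (N : nat) (eta : 'Z_(2 * N)) : R[i] :=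
  eps R N ^+ eta.

(* The parity of the exponent only depends on eta modulo 2N.                 *)
Definition nu (N M : nat) (eta : 'Z_(2 * N)) : int :=
  (-1) ^ ((eta : nat)%:Z - (1 - M%:Z)).

(* Endpoint space C^N: the basis |1>, ..., |N> is indexed by 'Z_N (|N> being *)
(* index 0), and 'Z_N is 'I_(edim N).                                        *)
Definition edim (N : nat) : nat := (Zp_trunc N).+2.

Definition Zop (R : realType) (N M : nat) : 'M[R[i]]_(edim N) :=
  \matrix_(i < edim N, j < edim N) (omega R N M ^+ j *+ (i == j)).

Definition Xop (R : realType) (N : nat) : 'M[R[i]]_(edim N) :=
  \matrix_(i < edim N, j < edim N) ((i : 'Z_N) == (j : 'Z_N) + 1)%:R.

Definition Yop (R : realType) (N M : nat) (m n : int) : 'M[R[i]]_(edim N) :=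
  Xop R N ^ m *m Zop R N M ^ n.

Definition sp (R : realType) : 'M[R[i]]_2 := delta_mx 0 1.
Definition sm (R : realType) : 'M[R[i]]_2 := delta_mx 1 0.
Definition sz (R : realType) : 'M[R[i]]_2 := delta_mx 0 0 - delta_mx 1 1.

(* For i, j : 'I_2 the product vector |i>|j> has index 2 * i + j in C^2 *t   *)
(* C^2, in accordance with |0> = |00>, |1> = |01>, |2> = |10>, |3> = |11>.   *)
Definition bond (R : realType) (N M : nat) : 'M[R[i]]_(2 * 2) :=
  let q := qpar R N M in
  q *: (sp R *t sm R) + q^-1 *: (sm R *t sp R)
  + ((q + q^-1) / 4) *: (sz R *t sz R).

Definition EY (R : realType) (N M : nat) (r c : nat) (m n : int) :
    'M[R[i]]_(2 * 2 * edim N) :=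
  (delta_mx (inord r) (inord c) : 'M_4) *t Yop R N M m n.

Inductive seam_sign := Plus | Minus.

Definition seam (R : realType) (N M : nat) (s : seam_sign) :
    'M[R[i]]_(2 * 2 * edim N) :=
  let q := qpar R N M in
  match s with
  | Plus => (1 / 2) *:
      (- EY R N M 0 1 (-1) (-1)
       + q ^ 3 *: EY R N M 0 2 (-1) 0
       - q ^ 4 *: EY R N M 0 3 (-2) (-1)
       - q ^ 2 *: EY R N M 1 0 1 1
       + q ^ 2 *: EY R N M 1 2 0 1
       - q *: EY R N M 1 3 (-1) 0
       + q ^ (-3) *: EY R N M 2 0 1 0
       + q ^ (-2) *: EY R N M 2 1 0 (-1)
       + q ^ 2 *: EY R N M 2 3 (-1) (-1)
       - EY R N M 3 0 2 1
       - q ^ (-1) *: EY R N M 3 1 1 0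
       + EY R N M 3 2 1 1)
  | Minus => (1 / 2) *:
      (EY R N M 0 1 (-1) 1
       - q *: EY R N M 0 2 (-1) 0
       - EY R N M 0 3 (-2) 1
       + q ^ (-2) *: EY R N M 1 0 1 (-1)
       + q ^ 2 *: EY R N M 1 2 0 (-1)
       + q ^ 3 *: EY R N M 1 3 (-1) 0
       - q ^ (-1) *: EY R N M 2 0 1 0
       + q ^ (-2) *: EY R N M 2 1 0 1
       - q ^ (-2) *: EY R N M 2 3 (-1) 1
       - q ^ (-4) *: EY R N M 3 0 2 (-1)
       + q ^ (-3) *: EY R N M 3 1 1 0
       - EY R N M 3 2 1 (-1))
  end.

Definition Fop (R : realType) (N : nat) (s : seam_sign) (eta : 'Z_(2 * N)) :
    'M[R[i]]_2 :=
  match s with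
  | Plus => delta_mx 0 0 + fpar R eta *: delta_mx 1 1
  | Minus => fpar R eta *: delta_mx 0 0 + delta_mx 1 1
  end.

Definition seam_eta (R : realType) (N M : nat) (s : seam_sign)
    (eta : 'Z_(2 * N)) : 'M[R[i]]_(2 * 2 * edim N) :=
  let FB (F : 'M[R[i]]_2) : 'M_(2 * 2 * edim N) := 1%:M *t F *t 1%:M in
  FB (Fop R s eta) *m seam R N M s *m FB ((Fop R s eta)^t*).

(* Basis of (C^2)^{*t L} *t C^N: a spin configuration on Z_L and an endpoint *)
(* index.                                                                    *)
Definition hdim (L N : nat) : nat := #|{: {ffun 'Z_L -> 'I_2} * 'Z_N}|.

Definition agree_off (L : nat) (i j : 'Z_L) (s t : {ffun 'Z_L -> 'I_2}) : bool :=
  [forall l, (l != i) && (l != j) ==> (s l == t l)].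

(* A acting on the ordered factors i, j (for i != j), as the identity on all *)
(* the others.                                                               *)
Definition on_sites (R : realType) (L N : nat) (i j : 'Z_L)
    (A : 'M[R[i]]_(2 * 2)) : 'M[R[i]]_(hdim L N) :=
  \matrix_(u < hdim L N, v < hdim L N)
    let: (s, m) := enum_val u in
    let: (t, n) := enum_val v in
    A (mxtens_index (s i, s j)) (mxtens_index (t i, t j))
    *+ (agree_off i j s t && (m == n)).

(* The same for the ordered factors i, j and the endpoint.                   *)
Definition on_sites_end (R : realType) (L N : nat) (i j : 'Z_L)
    (A : 'M[R[i]]_(2 * 2 * edim N)) : 'M[R[i]]_(hdim L N) :=
  \matrix_(u < hdim L N, v < hdim L N)
    let: (s, m) := enum_val u in
    let: (t, n) := enum_val v in
    A (mxtens_index (mxtens_index (s i, s j), m))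
      (mxtens_index (mxtens_index (t i, t j), n))
    *+ agree_off i j s t.

Definition hamiltonian (R : realType) (N M L : nat) (s : seam_sign)
    (eta : 'Z_(2 * N)) (k : 'Z_L) : 'M[R[i]]_(hdim L N) :=
  \sum_(j : 'Z_L | j != k - 1) on_sites N j (j + 1) (bond R N M)
  + on_sites_end (k - 1) k (seam_eta R M s eta).

(* Main.v *)
Require Import Defs.
From HB Require Import structures.
From mathcomp Require Import all_boot all_order all_algebra.
From mathcomp Require Import reals trigo complex mxtens spectral.
From mathcomp Require Import ring boolp.
Set Implicit Arguments.
Unset Strict Implicit.
Unset Printing Implicit Defensive.
Import GRing.Theory Num.Theory.
Local Open Scope ring_scope.
Local Open Scope complex_scope.

(** Two invertible operators that commute with H and anticommute with each other
preserve every eigenspace, and comparing the determinants of their two products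
there forces its dimension to be even.

The first is a spin flip W with site-dependent phases, combined with n -> c - n
on the endpoint. For the second, let zeta = f_eta Z and, for sigma = +,
  L_k = [[q^2, - q^3 X^-1 zeta^-1], [X, q zeta^-1]]
on the site k and the endpoint. Conjugation by L_k moves the seam from the bond
(k-1, k) to the bond (k, k+1), so L_k followed by the lattice translation by -1
is a symmetry T. Then W T = gamma T W, where gamma = q^(2L+1) f_eta omega^Q is a
function of the conserved charge Q = n - #{j | s_j = 1}, and W inverts gamma.
Hence (1 - gamma) T anticommutes with W. If nu_eta = 1, all values of gamma are
odd powers of exp(i pi / N), so gamma <> 1 and (1 - gamma) T is invertible.

The case sigma = - reduces to sigma = +: flipping all spins and n -> - n turns
H^- into H^+ with q replaced by q^-1 and the same f_eta. *)

(** * Determinants of anticommuting maps on an eigenspace *)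

Section AnticommutingSymmetries.
Variables (F : fieldType) (n : nat).
Hypothesis two_neq0 : (2 : F) != 0.

(** In coordinates on the eigenspace, of dimension r, the symmetries become invertible matrices with
    ab = -ba. Hence det a det b = (-1)^r det b det a, which is impossible for odd r. *)
Lemma anticommuting_rank_even (H A B : 'M[F]_n) (lambda : F) :
  A \in unitmx -> B \in unitmx -> comm_mx A H -> comm_mx B H ->
  A *m B = - (B *m A) -> ~~ odd (\rank (eigenspace H lambda)).
Proof.
move=> uA uB AH BH AB; set E := eigenspace H lambda.
have [R [freeR stab]] : exists R : 'M_(\rank E, n), row_free R /\
    forall C, comm_mx C H -> C \in unitmx ->
      exists2 c, c \in unitmx & R *m C = c *m R.
  exists (row_base E); split=> [|C CH uC]; first exact: row_base_free.
  have /submxP[c cE] : (row_base E *m C <= row_base E)%MS.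
    rewrite eq_row_base (eqmxMr C (eq_row_base E)).
    exact: comm_mx_stable_eigenspace.
  exists c => //; rewrite -row_full_unit -col_leq_rank.
  have := mxrankM_maxl c (row_base E); rewrite -cE mxrankMfree ?row_free_unit //.
  by rewrite eq_row_base.
have [a ua aE] := stab A AH uA; have [b ub bE] := stab B BH uB.
have ab : a *m b = - (b *m a).
  apply: (row_free_inj freeR).
  by rewrite /= mulNmx -!mulmxA -bE -aE !mulmxA -bE -aE -!mulmxA AB mulmxN.
have := congr1 determinant ab; rewrite -scaleN1r detZ !det_mulmx [\det b * _]mulrC.
rewrite -signr_odd; case: odd => // /eqP; rewrite expr1 mulN1r -subr_eq0 opprK.
rewrite -mulr2n -mulr_natl !mulf_eq0 (negPf two_neq0) /=.
by move: ua ub; rewrite !unitmxE !unitfE => /negPf-> /negPf->.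
Qed.
End AnticommutingSymmetries.

(** The ordinals carry the proof [isT], so that coefficient tables defined by matching on naturals
    compute after the case split. *)
Lemma ord2P (P : 'I_2 -> Prop) : P (@Ordinal 2 0 isT) -> P (@Ordinal 2 1 isT) -> forall a, P a.
Proof. by move=> P0 P1 [[|[|//]] i]; rewrite (bool_irrelevance i isT). Qed.

Lemma sum_ord2 (V : nmodType) (G : 'I_2 -> V) :
  \sum_a G a = G (@Ordinal 2 0 isT) + G (@Ordinal 2 1 isT).
Proof. by rewrite big_ord_recl big_ord1; congr (G _ + G _); apply: val_inj. Qed.

(** * Local operators of the ring *)

Section Coef.
Variables (F : fieldType) (N : nat) (q : F) (chi : 'Z_N -> F).
Hypothesis two_neq0 : (2 : F) != 0.
Hypothesis q_neq0 : q != 0.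
Hypothesis chi_neq0 : forall n, chi n != 0.
(** With [chi n] as the eigenvalue of zeta on |n>, this is the Weyl relation between zeta and X. *)
Hypothesis chiS : forall n, chi (n + 1) = q ^+ 2 * chi n.

(* In the coefficients below the spins on the output side come first, and x is
   the eigenvalue of zeta = f Z on the input side; the power of X is not recorded
   because it is fixed by conservation of the charge. *)
Definition bond_coef (q : F) (s1 s2 a b : nat) : F :=
  match s1, s2, a, b with
  | 0, 0, 0, 0 | 1, 1, 1, 1 => (q + q^-1) / 4
  | 0, 1, 0, 1 | 1, 0, 1, 0 => - ((q + q^-1) / 4)
  | 0, 1, 1, 0 => q
  | 1, 0, 0, 1 => q^-1
  | _, _, _, _ => 0
  end.

Definition seam_coef (q x : F) (s1 s2 a b : nat) : F :=
  match s1, s2, a, b with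
  | 0, 0, 0, 1 => - x^-1
  | 0, 0, 1, 0 => q ^+ 3
  | 0, 0, 1, 1 => - (q ^+ 4 * x^-1)
  | 0, 1, 0, 0 => - (q ^+ 2 * x)
  | 0, 1, 1, 0 => q ^+ 2 * x
  | 0, 1, 1, 1 => - q
  | 1, 0, 0, 0 => q ^- 3
  | 1, 0, 0, 1 => q ^- 2 * x^-1
  | 1, 0, 1, 1 => q ^+ 2 * x^-1
  | 1, 1, 0, 0 => - x
  | 1, 1, 0, 1 => - q^-1
  | 1, 1, 1, 0 => x
  | _, _, _, _ => 0
  end / 2.

Definition move_coef (q x : F) (s a : nat) : F :=
  match s, a with
  | 0, 0 => q ^+ 2
  | 0, 1 => - (q ^+ 3 * x^-1)
  | 1, 0 => 1
  | 1, 1 => q * x^-1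
  | _, _ => 0
  end.

(* The moved bond and the moved seam are a seam and a bond only up to a term on
   the common site, given by these coefficients; it cancels in the sum. *)
Definition corr_coef (q : F) (s a : nat) : F :=
  match s, a with
  | 0, 1 => (q - q^-1) / 4 * q ^+ 2
  | 1, 0 => - ((q - q^-1) / 4 * q ^- 2)
  | _, _ => 0
  end.

Lemma chi_natr n (m : nat) : chi (n + m%:R) = q ^+ (2 * m) * chi n.
Proof.
elim: m => [|m IH]; first by rewrite addr0 muln0 mul1r.
by rewrite -addn1 natrD addrA chiS IH mulnDr exprD muln1 mulrA [q ^+ 2 * _]mulrC.
Qed.

(** Expresses every shifted eigenvalue as a multiple of [chi n] by natural powers of q, the form
    that [field] can handle. *)
Lemma chi_shift n (a s : nat) :
  chi (n + (a%:R - s%:R)) = q ^+ (2 * a) / q ^+ (2 * s) * chi n.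
Proof.
have := chi_natr (n + (a%:R - s%:R)) s; rewrite -addrA subrK chi_natr => chiE.
apply: (mulfI (expf_neq0 (2 * s) q_neq0)).
by rewrite -chiE mulrA [_ * (_ / _)]mulrC divfK ?expf_neq0.
Qed.

(* The endpoint index on the input side of an entry <s|...|a> at endpoint index n
   on the output side. *)
Definition shift (n : 'Z_N) (s a : 'I_2) : 'Z_N := n + (a%:R - s%:R).

Definition kernel1 := 'I_2 -> 'I_2 -> 'Z_N -> F.
Definition kernel2 := 'I_2 -> 'I_2 -> 'I_2 -> 'I_2 -> 'Z_N -> F.

Definition comp_kernel (K K' : kernel2) : kernel2 := fun s1 s2 a b n =>
  \sum_c \sum_d K s1 s2 c d n * K' c d a b (shift (shift n s1 c) s2 d).
Definition left_kernel (K : kernel1) : kernel2 := fun s1 s2 a b n => K s1 a n *+ (s2 == b).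
Definition right_kernel (K : kernel1) : kernel2 := fun s1 s2 a b n => K s2 b n *+ (s1 == a).

Definition bondK : kernel2 := fun s1 s2 a b _ => bond_coef q s1 s2 a b.
Definition seamK : kernel2 := fun s1 s2 a b n =>
  seam_coef q (chi (shift (shift n s1 a) s2 b)) s1 s2 a b.
Definition moveK : kernel1 := fun s a n => move_coef q (chi (shift n s a)) s a.
Definition corrK : kernel1 := fun s a _ => corr_coef q s a.

Lemma four_neq0 : (4 : F) != 0.
Proof. by rewrite -[4%N]/(2 * 2)%N natrM mulf_neq0. Qed.

(** In operator form L_k h_{k,k+1} = (S_{k,k+1} - C_k) L_k, where C is the correction. Once all
    eigenvalues are expressed through [chi n], each of the sixteen entries is a rational
    identity. *)
Lemma move_bond s1 s2 a b n :
  comp_kernel (left_kernel moveK) bondK s1 s2 a b n =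
  comp_kernel
    (fun s1 s2 a b n => seamK s1 s2 a b n - left_kernel corrK s1 s2 a b n)
    (left_kernel moveK) s1 s2 a b n.
Proof.
have nz := (q_neq0, two_neq0, four_neq0, chi_neq0 n, oner_neq0 F).
rewrite /comp_kernel /left_kernel /seamK /moveK /corrK /bondK /seam_coef /shift !sum_ord2.
rewrite !chi_shift.
by move: s1 s2 a b; do 4! apply: ord2P; rewrite /= ?muln0 ?muln1 ?expr0; field; rewrite !nz.
Qed.

(** The counterpart L_k S_{k-1,k} = (h_{k-1,k} + C_k) L_k, with L_k now on the second site of the
    pair. *)
Lemma move_seam s1 s2 a b n :
  comp_kernel (right_kernel moveK) seamK s1 s2 a b n =
  comp_kernel
    (fun s1 s2 a b n => bondK s1 s2 a b n + right_kernel corrK s1 s2 a b n)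
    (right_kernel moveK) s1 s2 a b n.
Proof.
have nz := (q_neq0, two_neq0, four_neq0, chi_neq0 n, oner_neq0 F).
rewrite /comp_kernel /right_kernel /seamK /moveK /corrK /bondK /seam_coef /shift !sum_ord2.
rewrite !chi_shift.
by move: s1 s2 a b; do 4! apply: ord2P; rewrite /= ?muln0 ?muln1 ?expr0; field; rewrite !nz.
Qed.
End Coef.

(** * Operators acting on wave functions *)

Section Ops.
Variables (F : fieldType) (N L : nat).
Notation conf := {ffun 'Z_L -> 'I_2}.
Definition wave := conf -> 'Z_N -> F.
Implicit Types (psi : wave) (s : conf) (n : 'Z_N) (i j l : 'Z_L).

Definition upd s i (a : 'I_2) : conf := [ffun l => if l == i then a else s l].

Definition loc1 i (K : kernel1 F N) psi : wave := fun s n =>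
  \sum_a K (s i) a n * psi (upd s i a) (shift n (s i) a).
Definition loc2 i j (K : kernel2 F N) psi : wave := fun s n =>
  \sum_a \sum_b K (s i) (s j) a b n *
    psi (upd (upd s i a) j b) (shift (shift n (s i) a) (s j) b).
Definition locb i j (B : nat -> nat -> nat -> nat -> F) psi : wave := fun s n =>
  \sum_(a : 'I_2) \sum_(b : 'I_2) B (s i) (s j) a b * psi (upd (upd s i a) j b) n.

Lemma upd_eq s i a : upd s i a i = a.
Proof. by rewrite ffunE eqxx. Qed.

Lemma upd_neq s i a l : l != i -> upd s i a l = s l.
Proof. by rewrite ffunE => /negPf->. Qed.

Lemma upd_id s i : upd s i (s i) = s.
Proof. by apply/ffunP=> l; rewrite ffunE; case: eqP => [->|]. Qed.

Lemma updC s i j a b : i != j -> upd (upd s i a) j b = upd (upd s j b) i a.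
Proof.
move=> ij; apply/ffunP=> l; rewrite !ffunE.
by case: eqP => // ->; rewrite eq_sym (negPf ij).
Qed.

Lemma upd_upd s i a b : upd (upd s i a) i b = upd s i b.
Proof. by apply/ffunP=> l; rewrite !ffunE; case: eqP. Qed.

Lemma shift_id n a : shift n a a = n.
Proof. by rewrite /shift subrr addr0. Qed.

Lemma shiftA n a b c : shift (shift n a b) b c = shift n a c.
Proof. by rewrite /shift; ring. Qed.

Lemma shiftC n a b c d : shift (shift n a b) c d = shift (shift n c d) a b.
Proof. by rewrite /shift addrAC. Qed.

Lemma loc2_comp i j K K' psi s n : i != j ->
  loc2 i j K (loc2 i j K' psi) s n = loc2 i j (comp_kernel K K') psi s n.
Proof.
move=> ij; have ji : j != i by rewrite eq_sym.
have compE a b c d : psi (upd (upd (upd (upd s i c) j d) i a) j b)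
     (shift (shift (shift (shift n (s i) c) (s j) d) c a) d b) =
    psi (upd (upd s i a) j b) (shift (shift n (s i) a) (s j) b).
  rewrite (updC _ d a ji) !upd_upd; congr psi.
  by rewrite [shift (shift (shift n (s i) c) (s j) d) c a]shiftC !shiftA.
rewrite /loc2 /comp_kernel !sum_ord2 !upd_eq ![upd (upd _ i _) j _ i]upd_neq //.
rewrite !upd_eq !compE; ring.
Qed.

Lemma eq_loc2 i j (K K' : kernel2 F N) psi s n :
  (forall (s1 s2 a b : 'I_2) m, K s1 s2 a b m = K' s1 s2 a b m) ->
  loc2 i j K psi s n = loc2 i j K' psi s n.
Proof. by move=> eqK; apply: eq_bigr => a _; apply: eq_bigr => b _; rewrite eqK. Qed.

Lemma loc1_left i j K psi s n : i != j ->
  loc1 i K psi s n = loc2 i j (left_kernel K) psi s n.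
Proof.
move=> ij; apply: eq_bigr => a _; rewrite (bigD1 (s j)) //= big1 ?addr0.
  rewrite /left_kernel eqxx mulr1n shift_id -[s j](@upd_neq s i a) ?upd_id //.
  by rewrite eq_sym.
by move=> b /negPf sb; rewrite /left_kernel eq_sym sb mulr0n mul0r.
Qed.

Lemma loc1_right i j K psi s n : i != j ->
  loc1 j K psi s n = loc2 i j (right_kernel K) psi s n.
Proof.
move=> ij; rewrite /loc2 (bigD1 (s i)) //= [X in _ + X]big1 ?addr0.
  by apply: eq_bigr => b _; rewrite /right_kernel eqxx mulr1n shift_id upd_id.
move=> a /negPf sa; rewrite big1 // => b _.
by rewrite /right_kernel eq_sym sa mulr0n mul0r.
Qed.

(** Nonzero bond entries conserve the number of spins equal to 1, so the two endpoint shifts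
    cancel. *)
Lemma locb_loc2 (q : F) i j psi s n :
  locb i j (bond_coef q) psi s n = loc2 i j (@bondK F N q) psi s n.
Proof.
apply: eq_bigr => a _; apply: eq_bigr => b _; rewrite /bondK.
have [->|nz] := eqVneq (bond_coef q (s i) (s j) a b) 0; first by rewrite !mul0r.
congr (_ * psi _ _); move: nz; rewrite /shift.
move: (s i) (s j) a b; do 4! apply: ord2P; rewrite /= ?eqxx //; move=> _; ring.
Qed.

Lemma loc1_locb i j l K B psi s n : l != i -> l != j ->
  loc1 l K (locb i j B psi) s n = locb i j B (loc1 l K psi) s n.
Proof.
move=> li lj; have il : i != l by rewrite eq_sym.
have jl : j != l by rewrite eq_sym.
rewrite /loc1 /locb.
under eq_bigr do rewrite big_distrr /=.
rewrite exchange_big /=; apply: eq_bigr => a _.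
under eq_bigr do rewrite big_distrr /=.
rewrite exchange_big /=; apply: eq_bigr => b _.
rewrite big_distrr /=; apply: eq_bigr => c _.
rewrite !(upd_neq _ _ il) !(upd_neq _ _ jl) (upd_neq _ _ lj) (upd_neq _ _ li).
rewrite (updC _ _ _ li) (updC _ _ _ lj).
by rewrite mulrCA.
Qed.

Lemma loc1_sum (P : pred 'Z_L) i K (G : 'Z_L -> wave) psi s n :
  loc1 i K (fun s n => \sum_(j | P j) G j s n + psi s n) s n =
  \sum_(j | P j) loc1 i K (G j) s n + loc1 i K psi s n.
Proof.
rewrite /loc1 exchange_big -big_split /=; apply: eq_bigr => a _.
by rewrite mulrDr big_distrr.
Qed.
End Ops.

Lemma rev_ord2 : (rev_ord (@Ordinal 2 0 isT) = @Ordinal 2 1 isT) *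
  (rev_ord (@Ordinal 2 1 isT) = @Ordinal 2 0 isT).
Proof. by split; apply: val_inj. Qed.

Lemma val_Zp_opp1 L : (1 < L)%N -> nat_of_ord (-1 : 'Z_L)%R = L.-1.
Proof. by case: L => [|[|L]] // _; rewrite /= modn_small // modn_small // subn1. Qed.

Lemma val_Zp_succ L (d : 'Z_L) : (1 < L)%N -> d != -1 ->
  nat_of_ord (d + 1)%R = d.+1.
Proof.
move=> L1; rewrite -val_eqE /= -[X in _ != X]/(nat_of_ord (-1 : 'Z_L)%R) val_Zp_opp1 //.
case: L L1 d => [|[|L]] // _ d dL; rewrite /= [(1 %% _)%N]modn_small // addn1 modn_small //.
by have := ltn_ord d; rewrite ltnS leq_eqVlt (negPf dL).
Qed.

(** * The two symmetries *)

Section Sym.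
Variables (F : fieldType) (N L : nat) (q : F) (chi : 'Z_N -> F) (c : 'Z_N).
Hypothesis two_neq0 : (2 : F) != 0.
Hypothesis q_neq0 : q != 0.
Hypothesis chi_neq0 : forall n, chi n != 0.
Hypothesis chiS : forall n, chi (n + 1) = q ^+ 2 * chi n.
Hypothesis L_gt1 : (1 < L)%N.
Notation conf := {ffun 'Z_L -> 'I_2}.
Notation wave := (wave F N L).
Implicit Types (psi : wave) (s : conf) (n : 'Z_N) (i j l k : 'Z_L).

(** Stated over any field with abstract q and chi, so that one argument serves both signs of the
    seam. *)
Definition ham k psi : wave := fun s n =>
  \sum_(j | j != k - 1) locb j (j + 1) (bond_coef q) psi s n
  + loc2 (k - 1) k (seamK q chi) psi s n.

Definition seam_move k psi : wave := loc1 k (moveK q chi) psi.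

Lemma site_succ i : i + 1 != i.
Proof. by rewrite -subr_eq0 addrC addKr oner_neq0. Qed.

Lemma site_pred i : i - 1 != i.
Proof. by rewrite eq_sym -subr_eq0 opprB addrC subrK oner_neq0. Qed.

(** L_k commutes with the bonds away from site k, turns the bond (k, k+1) into a seam and the seam
    on (k-1, k) into a bond; the two corrections on site k cancel. *)
Lemma seam_move_ham k psi s n : seam_move k (ham k psi) s n = ham (k + 1) (seam_move k psi) s n.
Proof.
rewrite /seam_move /ham addrK loc1_sum.
(* The bond (k, k+1) is special on the left-hand side and the bond (k-1, k) on the right; all others
   are common. *)
rewrite (bigD1 k) 1?eq_sym ?site_pred //=.
rewrite [in RHS](bigD1 (k - 1)) ?site_pred //= subrK.
set M := loc1 k _ psi.
have kS : k != k + 1 by rewrite eq_sym site_succ.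
have -> : \sum_(i | (i != k - 1) && (i != k)) loc1 k (moveK q chi)
    (locb i (i + 1) (bond_coef q) psi) s n =
  \sum_(i | (i != k) && (i != k - 1)) locb i (i + 1) (bond_coef q) M s n.
  apply: eq_big => [i|i /andP[ik1 ik]]; first by rewrite andbC.
  by rewrite loc1_locb //; [rewrite eq_sym | rewrite -subr_eq eq_sym].
have bondE : locb k (k + 1) (bond_coef q) psi = loc2 k (k + 1) (@bondK F N q) psi.
  by apply/funext=> r; apply/funext=> m; rewrite locb_loc2.
rewrite bondE (loc1_left _ _ _ _ kS) loc2_comp //.
rewrite (eq_loc2 _ _ _ _ _ (move_bond two_neq0 q_neq0 chi_neq0 chiS)) -loc2_comp //.
have Ml : loc2 k (k + 1) (left_kernel (moveK q chi)) psi = M.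
  by apply/funext=> r; apply/funext=> m; rewrite -loc1_left.
have kP := site_pred k.
rewrite Ml (loc1_right _ _ _ _ kP) loc2_comp //.
rewrite (eq_loc2 _ _ _ _ _ (move_seam two_neq0 q_neq0 chi_neq0 chiS)) -loc2_comp //.
have Mr : loc2 (k - 1) k (right_kernel (moveK q chi)) psi = M.
  by apply/funext=> r; apply/funext=> m; rewrite -loc1_right.
have loc2B i j (K K' : kernel2 F N) :
    loc2 i j (fun (s1 s2 a b : 'I_2) m => K s1 s2 a b m - K' s1 s2 a b m) M s n =
    loc2 i j K M s n - loc2 i j K' M s n.
  rewrite /loc2 -sumrB; apply: eq_bigr => a _; rewrite -sumrB; apply: eq_bigr => b _.
  by rewrite mulrBl.
have loc2D i j (K K' : kernel2 F N) :
    loc2 i j (fun (s1 s2 a b : 'I_2) m => K s1 s2 a b m + K' s1 s2 a b m) M s n =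
    loc2 i j K M s n + loc2 i j K' M s n.
  rewrite /loc2 -big_split; apply: eq_bigr => a _; rewrite -big_split; apply: eq_bigr => b _.
  by rewrite mulrDl.
rewrite Mr loc2B loc2D -!locb_loc2 -loc1_left // -loc1_right //; ring.
Qed.

Definition rotc s : conf := [ffun l => s (l - 1)].

Lemma rotcS s i : rotc s (i + 1) = s i.
Proof. by rewrite ffunE addrK. Qed.

Lemma upd_rotc s i a : upd (rotc s) (i + 1) a = rotc (upd s i a).
Proof. by apply/ffunP=> l; rewrite !ffunE -subr_eq. Qed.

(** The symmetry T: the rotation brings the seam from (k, k+1) back to (k-1, k). *)
Definition seam_transl k psi : wave := fun s n => seam_move k psi (rotc s) n.

Lemma loc2_rotc i j K psi s n :
  loc2 (i + 1) (j + 1) K psi (rotc s) n = loc2 i j K (fun s n => psi (rotc s) n) s n.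
Proof.
by apply: eq_bigr => a _; apply: eq_bigr => b _; rewrite !rotcS !upd_rotc.
Qed.

Lemma seam_transl_ham k psi s n : seam_transl k (ham k psi) s n = ham k (seam_transl k psi) s n.
Proof.
rewrite /seam_transl seam_move_ham /ham addrK; congr (_ + _).
  rewrite (reindex_inj (addIr 1)) /=; apply: eq_big => [i|i _].
    by rewrite [i == _]eq_sym subr_eq eq_sym.
  by rewrite !locb_loc2 loc2_rotc.
by rewrite -{1}[k](subrK 1) loc2_rotc.
Qed.

(** * The conserved charge *)

Definition charge s n : 'Z_N := n - \sum_j (s j)%:R.

Lemma charge_upd s i a n : charge (upd s i a) (shift n (s i) a) = charge s n.
Proof.
rewrite /charge /shift (bigD1 i) //= [in RHS](bigD1 i) //= upd_eq.
under eq_bigr => j ji do rewrite upd_neq //.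
by ring.
Qed.

Lemma loc2_charge (g : 'Z_N -> F) i j K psi s n : i != j ->
  loc2 i j K (fun s n => g (charge s n) * psi s n) s n =
  g (charge s n) * loc2 i j K psi s n.
Proof.
move=> ij; rewrite /loc2 big_distrr; apply: eq_bigr => a _; rewrite big_distrr.
apply: eq_bigr => b _ /=; rewrite mulrCA; congr (g _ * _).
by rewrite -[s j](@upd_neq _ s i a) 1?eq_sym // !charge_upd.
Qed.

Lemma ham_charge (g : 'Z_N -> F) k psi s n :
  ham k (fun s n => g (charge s n) * psi s n) s n =
  g (charge s n) * ham k psi s n.
Proof.
rewrite /ham mulrDr loc2_charge ?site_pred //; congr (_ + _).
rewrite big_distrr /=; apply: eq_bigr => i _; rewrite !locb_loc2 loc2_charge //.
by rewrite eq_sym site_succ.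
Qed.

(** * The spin flip with phases, W *)

Hypothesis chiC : forall n, chi n * chi (c - n) = q ^- (2 * L + 2).

Definition flip s : conf := [ffun l => rev_ord (s l)].

Lemma flipK : involutive flip.
Proof. by move=> s; apply/ffunP=> l; rewrite !ffunE rev_ordK. Qed.

Lemma upd_flip s i a : upd (flip s) i (rev_ord a) = flip (upd s i a).
Proof. by apply/ffunP=> l; rewrite !ffunE; case: eqP. Qed.

Lemma rotc_flip s : rotc (flip s) = flip (rotc s).
Proof. by apply/ffunP=> l; rewrite !ffunE. Qed.

Lemma shift_flip n (a b : 'I_2) : shift (c - n) (rev_ord a) (rev_ord b) = c - shift n a b.
Proof. by rewrite /shift; move: a b; do 2! apply: ord2P; rewrite !rev_ord2 /=; ring. Qed.

(* The factor q^2 per site compensates for the flip exchanging q and q^-1 in the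
   bonds; the offset is dictated by the seam. *)
Definition site_phase k j : F := - q ^+ (2 * (j - k)%R) / q ^+ (2 * L + 2).

Lemma site_phase_neq0 k j : site_phase k j != 0.
Proof. by rewrite /site_phase mulf_neq0 ?invr_neq0 ?oppr_eq0 ?expf_neq0. Qed.

Lemma site_phase_home k : site_phase k k = - q ^- (2 * L + 2).
Proof. by rewrite /site_phase subrr muln0 mulN1r. Qed.

Lemma site_phase_last k : site_phase k (k - 1) = - q ^- 4.
Proof.
rewrite /site_phase addrAC subrr sub0r val_Zp_opp1 //.
have -> : (2 * L + 2 = 2 * L.-1 + 4)%N by rewrite -{1}(prednK (ltnW L_gt1)); ring.
by rewrite exprD invfM mulrA mulNr divff ?expf_neq0 // mulN1r.
Qed.

(** The excluded j = k-1 is where the representative of j - k wraps from L-1 to 0; that pair of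
    sites carries the seam. *)
Lemma site_phaseS k j : j != k - 1 -> site_phase k (j + 1) = q ^+ 2 * site_phase k j.
Proof.
move=> jk; rewrite /site_phase mulrA mulrN -exprD addrAC.
by rewrite val_Zp_succ ?mulnS // subr_eq addrC.
Qed.

Definition weight k s : F := \prod_j site_phase k j ^+ s j.

Lemma weight_upd k s i a :
  weight k (upd s i a) * site_phase k i ^+ s i = weight k s * site_phase k i ^+ a.
Proof.
rewrite /weight (bigD1 i) //= [in RHS](bigD1 i) //= upd_eq.
under eq_bigr => j ji do rewrite upd_neq //.
by ring.
Qed.

Lemma weight_neq0 k s : weight k s != 0.
Proof. by apply/prodf_neq0 => j _; rewrite expf_neq0 ?site_phase_neq0. Qed.

Definition charge_conj k psi : wave := fun s n => weight k s * psi (flip s) (c - n).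

(** Only the phases of the sites i and j change under the operator, so commutation with W reduces to
    a condition on the kernel. *)
Lemma loc2_charge_conj k i j (K : kernel2 F N) psi s n : i != j ->
  (forall (s1 s2 a b : 'I_2) m,
    site_phase k i ^+ s1 * site_phase k j ^+ s2 *
      K (rev_ord s1) (rev_ord s2) (rev_ord a) (rev_ord b) (c - m) =
    K s1 s2 a b m * (site_phase k i ^+ a * site_phase k j ^+ b)) ->
  charge_conj k (loc2 i j K psi) s n = loc2 i j K (charge_conj k psi) s n.
Proof.
move=> ij Kflip; rewrite /charge_conj /loc2 (reindex_inj rev_ord_inj) big_distrr /=.
apply: eq_bigr => a _; rewrite (reindex_inj rev_ord_inj) big_distrr /=.
apply: eq_bigr => b _; rewrite [flip s i]ffunE [flip s j]ffunE !upd_flip !shift_flip.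
rewrite !mulrA; congr (_ * _).
have nzi := expf_neq0 (s i) (site_phase_neq0 k i).
have nzj := expf_neq0 (s j) (site_phase_neq0 k j).
(* Multiplying by the output phases makes [weight_upd] applicable without division. *)
apply: (mulIf nzi); apply: (mulIf nzj).
have -> : K (s i) (s j) a b n * weight k (upd (upd s i a) j b) *
    site_phase k i ^+ s i * site_phase k j ^+ s j =
  K (s i) (s j) a b n * (weight k (upd (upd s i a) j b) *
    site_phase k j ^+ upd s i a j) * site_phase k i ^+ s i.
  by rewrite upd_neq 1?eq_sym //; ring.
rewrite weight_upd mulrA -[X in _ = X]mulrA [site_phase k j ^+ b * _]mulrC.
rewrite -!mulrA [weight k (upd _ _ _) * _]mulrA weight_upd.
have := Kflip (s i) (s j) a b n => /(congr1 ( *%R (weight k s))) KE.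
transitivity (weight k s * (K (s i) (s j) a b n * (site_phase k i ^+ a * site_phase k j ^+ b))).
  by rewrite -KE; ring.
ring.
Qed.

(** The flip exchanges the hopping amplitudes q and q^-1, and the ratio q^2 of neighbouring phases
    undoes this. *)
Lemma bond_flip k j (s1 s2 a b : 'I_2) m : j != k - 1 ->
  site_phase k j ^+ s1 * site_phase k (j + 1) ^+ s2 *
    @bondK F N q (rev_ord s1) (rev_ord s2) (rev_ord a) (rev_ord b) (c - m) =
  @bondK F N q s1 s2 a b m * (site_phase k j ^+ a * site_phase k (j + 1) ^+ b).
Proof.
move=> jk; rewrite (site_phaseS jk) /bondK.
have nz := (q_neq0, two_neq0, four_neq0 two_neq0, oner_neq0 F).
by move: s1 s2 a b; do 4! apply: ord2P; rewrite !rev_ord2 /= ?expr0; field; rewrite ?nz.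
Qed.

(** The reflection replaces chi by q^-(2L+2) / chi; the phases -q^-4 and -q^-(2L+2) of the sites k-1
    and k restore the seam entries. *)
Lemma seam_flip k (s1 s2 a b : 'I_2) m :
  site_phase k (k - 1) ^+ s1 * site_phase k k ^+ s2 *
    seamK q chi (rev_ord s1) (rev_ord s2) (rev_ord a) (rev_ord b) (c - m) =
  seamK q chi s1 s2 a b m * (site_phase k (k - 1) ^+ a * site_phase k k ^+ b).
Proof.
rewrite site_phase_last site_phase_home /seamK !shift_flip.
move: (shift _ s2 b) => x.
have -> : chi (c - x) = q ^- (2 * L + 2) / chi x.
  by rewrite -(chiC x) mulrAC divff // mul1r.
move: (chi x) (chi_neq0 x) (expf_neq0 (2 * L + 2) q_neq0) => y y0.
move: (q ^+ (2 * L + 2)) => Q Q0.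
have nz := (q_neq0, two_neq0, y0, Q0, oner_neq0 F).
rewrite /seam_coef; move: s1 s2 a b.
by do 4! apply: ord2P; rewrite !rev_ord2 /= ?expr0; field; rewrite ?nz.
Qed.

Lemma charge_conj_ham k psi s n : charge_conj k (ham k psi) s n = ham k (charge_conj k psi) s n.
Proof.
rewrite {1}/charge_conj /ham mulrDr big_distrr /=; congr (_ + _).
  apply: eq_bigr => j jk; rewrite !locb_loc2 -loc2_charge_conj //.
    by rewrite eq_sym site_succ.
  by move=> *; apply: bond_flip.
rewrite -loc2_charge_conj ?site_pred // => *; exact: seam_flip.
Qed.

(** The factor gamma of W T = gamma T W. *)
Definition monodromy m : F := q ^+ (2 * L + 1) * chi m.

(** The part of W T = gamma T W seen on the site k and the endpoint. Here e is the spin arriving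
    from site k-1, hence the phase of that site; [q ^+ (2 * e)] is its share of the power of q in
    [weight_rotc]. *)
Lemma move_flip k (e a : 'I_2) n :
  moveK q chi (rev_ord e) (rev_ord a) (c - n) * (q ^+ (2 * e) * site_phase k (k - 1) ^+ e) =
  q ^+ (2 * L + 1) * chi n * moveK q chi e a n * site_phase k k ^+ a.
Proof.
rewrite site_phase_last site_phase_home /moveK !shift_flip /shift.
have -> : chi n = q ^+ (2 * e) / q ^+ (2 * a) * chi (n + (a%:R - e%:R)).
  by rewrite -(chi_shift q_neq0 chiS); congr chi; ring.
move: (n + _) => x.
have -> : chi (c - x) = q ^- (2 * L + 2) / chi x.
  by rewrite -(chiC x) mulrAC divff // mul1r.
have -> : (2 * L + 2 = 2 * L + 1 + 1)%N by rewrite -addnA.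
rewrite exprD expr1.
move: (chi x) (chi_neq0 x) (expf_neq0 (2 * L + 1) q_neq0) => y y0.
move: (q ^+ (2 * L + 1)) => Q Q0.
have nz := (q_neq0, y0, Q0, oner_neq0 F).
rewrite /move_coef; move: e a; do 2! apply: ord2P;
  by rewrite !rev_ord2 /= ?muln0 ?muln1 ?expr0; field; rewrite ?nz.
Qed.

(** The rotation carries every spin except the one from k-1 to a site whose phase has an extra
    factor q^2. The spin arriving at k is overwritten by a, and its own factors are put on the
    left. *)
Lemma weight_rotc k s a :
  weight k (upd (rotc s) k a) * (q ^+ (2 * rotc s k) * site_phase k (k - 1) ^+ rotc s k) =
  site_phase k k ^+ a * (q ^+ (2 * \sum_j s j) * weight k s).
Proof.
rewrite /weight (bigD1 k) //= upd_eq.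
under eq_bigr => j jk do rewrite upd_neq //.
rewrite (reindex_inj (addIr 1)) /= (bigD1 (k - 1) (F := fun j => s j : nat)) //=.
rewrite [X in _ = _ * (_ * X)](bigD1 (k - 1)) //= mulnDr exprD big_distrr /=.
have -> : \prod_(j | j + 1 != k) site_phase k (j + 1) ^+ rotc s (j + 1) =
    q ^+ (\sum_(j | j != k - 1) 2 * s j) * \prod_(j | j != k - 1) site_phase k j ^+ s j.
  rewrite expr_sum -big_split /=; apply: eq_big => [j|j jk].
    by rewrite [j == _]eq_sym subr_eq eq_sym.
  have jk1 : j != k - 1 by apply: contraNneq jk => ->; rewrite subrK.
  by rewrite rotcS (site_phaseS jk1) exprMn exprM.
have -> : rotc s k = s (k - 1) by rewrite -{1}[k](subrK 1) rotcS.
by rewrite -!mulrA; congr (_ * _); ring.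
Qed.

Lemma charge_conj_seam_transl k psi s n :
  charge_conj k (seam_transl k psi) s n =
  monodromy (charge s n) * seam_transl k (charge_conj k psi) s n.
Proof.
rewrite /charge_conj /seam_transl /seam_move /loc1 rotc_flip (reindex_inj rev_ord_inj) !big_distrr.
apply: eq_bigr => a _ /=.
rewrite [flip (rotc s) k]ffunE upd_flip shift_flip !mulrA; congr (_ * _).
set e := rotc s k.
have nz : q ^+ (2 * e) * site_phase k (k - 1) ^+ e != 0.
  by rewrite mulf_neq0 ?expf_neq0 ?site_phase_neq0.
apply: (mulIf nz); rewrite -!mulrA move_flip /e weight_rotc.
(* The power of q collected by the rotation joins chi of the charge to give [chi n], the factor
   supplied by [move_flip]. *)
have -> : chi n = q ^+ (2 * \sum_j s j) * chi (charge s n).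
  by rewrite -(chi_natr chiS) /charge -natr_sum subrK.
by rewrite /monodromy; ring.
Qed.

Lemma charge_flip s n : charge (flip s) (c - n) = c - charge s n - L%:R.
Proof.
have -> : L%:R = \sum_(j : 'Z_L) 1 :> 'Z_N.
  by rewrite sumr_const card_ord; congr (_ *+ _); rewrite Zp_cast.
rewrite /charge.
have -> : \sum_j (flip s j)%:R = \sum_(j : 'Z_L) 1 - \sum_j (s j)%:R :> 'Z_N.
  rewrite -sumrB; apply: eq_bigr => j _; rewrite ffunE.
  by move: (s j); apply: ord2P; rewrite rev_ord2 /=; ring.
ring.
Qed.

(** W sends the charge m to c - m - L; the exponent 2L + 1 in gamma makes the product exactly 1. *)
Lemma monodromy_flip s n :
  monodromy (charge (flip s) (c - n)) * monodromy (charge s n) = 1.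
Proof.
rewrite charge_flip /monodromy; set m := charge s n.
have : chi (c - m) = q ^+ (2 * L) * chi (c - m - L%:R).
  by rewrite -(chi_natr chiS) subrK.
have -> : chi (c - m) = q ^- (2 * L + 2) / chi m.
  by rewrite -(chiC m) mulrAC divff // mul1r.
move=> E; apply: (mulfI (expf_neq0 (2 * L) q_neq0)).
have -> : q ^+ (2 * L) * (q ^+ (2 * L + 1) * chi (c - m - L%:R) * (q ^+ (2 * L + 1) * chi m)) =
  q ^+ (2 * L) * chi (c - m - L%:R) * (q ^+ (2 * L + 1) * q ^+ (2 * L + 1) * chi m) by ring.
rewrite -E -exprD mulr1.
have -> : (2 * L + 1 + (2 * L + 1) = 2 * L + 2 + 2 * L)%N by ring.
rewrite (exprD _ (2 * L + 2)); move: (q ^+ (2 * L + 2)) (expf_neq0 (2 * L + 2) q_neq0) => Q Q0.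
by field; rewrite Q0 chi_neq0.
Qed.

Definition dressed_transl k psi : wave := fun s n =>
  (1 - monodromy (charge s n)) * seam_transl k psi s n.

(** W (1 - gamma) T = (1 - gamma^-1) gamma T W = -(1 - gamma) T W. *)
Lemma dressed_transl_charge_conj k psi s n :
  charge_conj k (dressed_transl k psi) s n = - dressed_transl k (charge_conj k psi) s n.
Proof.
rewrite /dressed_transl {1}/charge_conj mulrCA.
rewrite -[weight k s * _]/(charge_conj k (seam_transl k psi) s n).
rewrite charge_conj_seam_transl.
by rewrite mulrA mulrBl mul1r monodromy_flip -opprB mulNr.
Qed.

Lemma dressed_transl_ham k psi s n :
  dressed_transl k (ham k psi) s n = ham k (dressed_transl k psi) s n.
Proof.
rewrite /dressed_transl seam_transl_ham.
by rewrite (ham_charge (fun m => 1 - monodromy m) k (seam_transl k psi)).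
Qed.

(** * Linearity and injectivity of the symmetries *)

Definition op_linear (A : wave -> wave) := forall a phi psi s n,
  A (fun s n => a * phi s n + psi s n) s n = a * A phi s n + A psi s n.
Definition op_injective (A : wave -> wave) := forall psi,
  (forall s n, A psi s n = 0) -> forall s n, psi s n = 0.

Lemma charge_conj_linear k : op_linear (charge_conj k).
Proof. by move=> a phi psi s n; rewrite /charge_conj; ring. Qed.

Lemma dressed_transl_linear k : op_linear (dressed_transl k).
Proof.
move=> a phi psi s n; rewrite /dressed_transl /seam_transl /seam_move /loc1 !sum_ord2; ring.
Qed.

Lemma charge_conj_injective k : op_injective (charge_conj k).
Proof.
move=> psi psi0 s n; move/eqP: (psi0 (flip s) (c - n)).
by rewrite /charge_conj flipK subKr mulf_eq0 (negPf (weight_neq0 _ _)) => /eqP.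
Qed.

(** L_k splits into 2 x 2 blocks pairing spin 0 at endpoint m with spin 1 at endpoint m + 1, of
    determinant 2 q^3 / chi(m + 1). *)
Lemma seam_move_injective k : op_injective (seam_move k).
Proof.
move=> psi psi0 s n.
suff H r m : psi (upd r k (@Ordinal 2 0 isT)) m = 0 /\ psi (upd r k (@Ordinal 2 1 isT)) (m + 1) = 0.
  case: (H s n) (H s (n - 1)) => H0 _ [_]; rewrite subrK => H1.
  by rewrite -(upd_id s k); move: (s k); apply: ord2P.
have := psi0 (upd r k (@Ordinal 2 0 isT)) m.
have := psi0 (upd r k (@Ordinal 2 1 isT)) (m + 1).
rewrite /seam_move /loc1 !sum_ord2 !upd_eq !upd_upd /moveK /move_coef !shift_id.
have -> : shift (m + 1) (@Ordinal 2 1 isT) (@Ordinal 2 0 isT) = m.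
  by rewrite -[LHS]/(m + 1 + (0 - 1)) sub0r addrK.
have -> : shift m (@Ordinal 2 0 isT) (@Ordinal 2 1 isT) = m + 1.
  by rewrite -[LHS]/(m + (1 - 0)) subr0.
move: (psi _ m) (psi _ (m + 1)) => x y /= e1 e0.
have y0 := chi_neq0 (m + 1).
(* Adding q^2 times [e1] to [e0] leaves 2 q^2 x = 0. *)
have x0 : x = 0.
  apply: (mulfI (mulf_neq0 two_neq0 (expf_neq0 2 q_neq0))); rewrite mulr0.
  rewrite -[RHS]addr0 -[in X in _ + X](mulr0 (q ^+ 2)) -{1}e0 -e1; ring.
split => //; move/eqP: e1; rewrite x0 mulr0 add0r mulf_eq0.
by rewrite (negPf (mulf_neq0 q_neq0 (invr_neq0 y0))) => /eqP.
Qed.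

Hypothesis monodromy_neq1 : forall m, monodromy m != 1.

Lemma dressed_transl_injective k : op_injective (dressed_transl k).
Proof.
move=> psi psi0; apply: (@seam_move_injective k) => s n.
pose r : conf := [ffun l => s (l + 1)].
have rE : rotc r = s by apply/ffunP=> l; rewrite !ffunE subrK.
move/eqP: (psi0 r n); rewrite /dressed_transl /seam_transl rE mulf_eq0.
by rewrite subr_eq0 eq_sym (negPf (monodromy_neq1 _)) => /eqP.
Qed.

End Sym.

(** * Matrix entries of the seam *)

Section Weyl.
Variables (R : realType) (N M : nat).
Let q := qpar R N M.
Hypothesis q_neq0 : q != 0.

Lemma Xop_exp (m : int) (i j : 'I_(edim N)) :
  (Xop R N ^ m)%R i j = ((i : 'Z_N) == (j : 'Z_N) + m%:~R)%:R.
Proof.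
pose Xs (a : 'Z_N) : 'M[R[i]]_(edim N) := \matrix_(i, j) ((i : 'Z_N) == (j : 'Z_N) + a)%:R.
have XsM a b : Xs a * Xs b = Xs (a + b).
  apply/matrixP=> u w; rewrite !mxE (bigD1 (w + b : 'Z_N)) //= big1 ?addr0.
    by rewrite !mxE eqxx mulr1 -addrA [b + a]addrC.
  by move=> x xw; rewrite !mxE (negPf xw) mulr0.
have Xs0 : Xs 0 = 1 by apply/matrixP=> u w; rewrite !mxE addr0.
have X1 : Xop R N = Xs 1 by [].
have XE n : Xs 1 ^+ n = Xs n%:R.
  by elim: n => [|n IH]; rewrite ?expr0 ?Xs0 // exprS IH XsM -natr1 addrC.
suff -> : Xop R N ^ m = Xs m%:~R by rewrite mxE.
rewrite X1; case: m => n; first by rewrite -exprnP XE.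
rewrite NegzE -exprnN XE mulrNz.
(* The ring inverse is a true inverse only for units, so invertibility comes before negative
   powers. *)
have XsU : Xs n.+1%:R \is a GRing.unit.
  by apply/unitrP; exists (Xs (- n.+1%:R)); rewrite !XsM addNr subrr Xs0.
by apply: (mulrI XsU); rewrite XsM subrr Xs0 divrr.
Qed.

Lemma Zop_exp (m : int) : 
  Zop R N M ^ m = \matrix_(i, j) ((q ^+ (2 * j)) ^ m *+ (i == j)).
Proof.
pose D (g : 'I_(edim N) -> R[i]) : 'M[R[i]]_(edim N) := \matrix_(i, j) (g j *+ (i == j)).
have DM g h : D g * D h = D (fun j => g j * h j).
  apply/matrixP=> u w; rewrite !mxE (bigD1 w) //= big1 ?addr0.
    by rewrite !mxE eqxx mulr1n mulrnAl.
  by move=> x xw; rewrite !mxE (negPf xw) mulr0.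
have D1 : D (fun=> 1) = 1 by apply/matrixP=> u w; rewrite !mxE.
have eqD g h : g =1 h -> D g = D h by move=> gh; apply/matrixP=> u w; rewrite !mxE gh.
have ZD : Zop R N M = D (fun j => q ^+ (2 * j)).
  by apply/matrixP=> u w; rewrite !mxE exprM.
have ZE n : D (fun j => q ^+ (2 * j)) ^+ n = D (fun j => (q ^+ (2 * j)) ^+ n).
  elim: n => [|n IH]; first by rewrite expr0 -D1; apply: eqD => j.
  by rewrite exprS IH DM; apply: eqD => j; rewrite exprS.
rewrite ZD; case: m => n; first by rewrite -exprnP ZE; apply/matrixP=> u w; rewrite !mxE.
have nz j : (q ^+ (2 * j)) ^+ n.+1 != 0 by do 2! apply: expf_neq0.
have U : D (fun j => (q ^+ (2 * j)) ^+ n.+1) \is a GRing.unit.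
  apply/unitrP; exists (D (fun j => (q ^+ (2 * j)) ^- n.+1)).
  by rewrite !DM -D1; split; apply: eqD => j; rewrite ?mulVf ?mulfV.
rewrite NegzE -exprnN ZE; apply: (mulrI U); rewrite divrr //.
rewrite -[\matrix_(i, j) _]/(D (fun j => (q ^+ (2 * j)) ^ (- (n.+1)%:Z))) DM -D1.
by apply: eqD => j; rewrite -exprnN mulfV.
Qed.

Lemma Yop_entry (m z : int) (i j : 'Z_N) :
  Yop R N M m z i j = (q ^+ (2 * j)) ^ z *+ (i == j + m%:~R).
Proof.
rewrite /Yop Zop_exp !mxE (bigD1 j) //= big1 ?addr0.
  by rewrite Xop_exp mxE eqxx mulr1n mulr_natl.
by move=> x xw; rewrite !mxE (negPf xw) mulr0.
Qed.

Definition pair_code (s1 s2 : nat) : nat :=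
  match s1, s2 with 0, 0 => 0 | 0, _ => 1 | _, 0 => 2 | _, _ => 3 end%N.

Definition basis3 (s1 s2 : 'I_2) (n : 'Z_N) : 'I_(2 * 2 * edim N) :=
  mxtens_index (mxtens_index (s1, s2), n).

Lemma EY_entry (r0 c0 : nat) (m z : int) (s1 s2 a b : 'I_2) (i j : 'Z_N) :
  (r0 < 4)%N -> (c0 < 4)%N ->
  EY R N M r0 c0 m z (basis3 s1 s2 i) (basis3 a b j) =
  (q ^+ (2 * j)) ^ z *+ [&& pair_code s1 s2 == r0, pair_code a b == c0 & i == j + m%:~R].
Proof.
move=> r4 c4; rewrite /EY tensmxE mxE Yop_entry.
have pair_codeE (u w : 'I_2) (t : nat) : (t < 4)%N ->
    (mxtens_index (u, w) == inord t :> 'I_4) = (pair_code u w == t).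
  move=> t4; rewrite -val_eqE /= inordK //.
  by move: u w; do 2! apply: ord2P.
by rewrite !pair_codeE // mulr_natl -mulrnA mulnb andbC -andbA.
Qed.

Lemma smallintE : (((0 : int)%:~R = 0 :> 'Z_N) * ((1 : int)%:~R = 1 :> 'Z_N) *
  ((-1 : int)%:~R = -1 :> 'Z_N) *
  ((2 : int)%:~R = 1 + 1 :> 'Z_N) * ((-2 : int)%:~R = - 1 - 1 :> 'Z_N)).
Proof. by do !split => //; rewrite -?opprD. Qed.

Lemma zpowE (y : R[i]) : (y ^ 0 = 1) * (y ^ 1 = y) * (y ^ (-1) = y^-1) *
  (y ^ 2 = y ^+ 2) * (y ^ 3 = y ^+ 3) * (y ^ 4 = y ^+ 4) * (y ^ (-2) = y ^- 2) *
  (y ^ (-3) = y ^- 3) * (y ^ (-4) = y ^- 4).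
Proof. by []. Qed.

Let simpE := (mulr0n, mulr1n, add0r, addr0, sub0r, subr0, subrr, addrK, mulr0, mul0r,
  mul0rn, oppr0).

Lemma seam_plus_entry (s1 s2 a b : 'I_2) (i j : 'Z_N) :
  seam R N M Plus (basis3 s1 s2 i) (basis3 a b j) =
  seam_coef q (q ^+ (2 * j)) s1 s2 a b *+ (i == j + (s1%:R + s2%:R - a%:R - b%:R)).
Proof.
(* [EY] and [basis3] become variables known only through [EY_entry], so that the case split does not
   unfold tensor products. *)
rewrite /seam -/q; move: (EY R N M) EY_entry => G GE; move: basis3 GE => B GE.
clearbody q; rewrite !mxE !GE //.
move: (q ^+ (2 * j)) => x.
rewrite !smallintE /seam_coef.
move: s1 s2 a b; do 4! apply: ord2P; rewrite /= ?simpE //.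
all: by case: (i == _); rewrite ?simpE // ?zpowE; ring.
Qed.

(** S_- is S_+ with q inverted, spins flipped and the endpoint reflected; the reflection undoes the
    inversion in q^(2j), so the eigenvalue of Z is kept. *)
Lemma seam_minus_entry (s1 s2 a b : 'I_2) (i j : 'Z_N) :
  seam R N M Minus (basis3 s1 s2 i) (basis3 a b j) =
  seam_coef q^-1 (q ^+ (2 * j)) (rev_ord s1) (rev_ord s2) (rev_ord a) (rev_ord b)
    *+ (i == j + (s1%:R + s2%:R - a%:R - b%:R)).
Proof.
rewrite /seam -/q; move: (EY R N M) EY_entry => G GE; move: basis3 GE => B GE.
clearbody q; rewrite !mxE !GE //.
move: (q ^+ (2 * j)) => x.
rewrite !smallintE /seam_coef.
move: s1 s2 a b; do 4! apply: ord2P; rewrite !rev_ord2 /= ?simpE //.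
all: by case: (i == _); rewrite ?simpE // ?zpowE -?exprVn ?invrK; ring.
Qed.

End Weyl.

(** * Wave functions and row vectors *)

Section Action.
Variables (F : fieldType) (N L : nat).
Notation conf := {ffun 'Z_L -> 'I_2}.
Notation state := (conf * 'Z_N)%type.
Notation wave := (wave F N L).
Implicit Types (v : 'rV[F]_#|{: state}|) (psi : wave) (s t : conf) (m n : 'Z_N).

Definition wave_of v : wave := fun s n => v 0 (enum_rank (s, n)).
Definition row_of psi : 'rV[F]_#|{: state}| :=
  \row_u psi (enum_val u).1 (enum_val u).2.

Lemma row_ofK psi : wave_of (row_of psi) = psi.
Proof. by apply/funext=> s; apply/funext=> n; rewrite /wave_of mxE enum_rankK. Qed.

Lemma wave_ofK v : row_of (wave_of v) = v.
Proof. by apply/rowP=> u; rewrite mxE /wave_of -surjective_pairing enum_valK. Qed.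

Lemma sum_state (G : state -> F) :
  \sum_(u < #|{: state}|) G (enum_val u) = \sum_s \sum_n G (s, n).
Proof.
rewrite (reindex (@enum_rank _)) /=; last exact/onW_bij/enum_rank_bij.
under eq_bigr do rewrite enum_rankK.
by rewrite pair_big /=; apply: eq_bigr => -[].
Qed.

Section Linear.
Variable A : wave -> wave.
Hypothesis A_linear : op_linear A.

Definition row_op v := row_of (A (wave_of v)).

Lemma row_op_linear : linear row_op.
Proof.
move=> a v w; apply/rowP=> u; rewrite !mxE -A_linear.
by congr A; apply/funext=> s; apply/funext=> n; rewrite /wave_of !mxE.
Qed.

HB.instance Definition _ :=
  @GRing.isLinear.Build F _ _ _ row_op row_op_linear.

(** Rows are multiplied from the right, so a matrix product applies its left factor first. *)
Definition op_mx : 'M[F]_#|{: state}| := lin1_mx row_op.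

Lemma wave_of_op_mx v : wave_of (v *m op_mx) = A (wave_of v).
Proof. by rewrite mul_rV_lin1 row_ofK. Qed.

Lemma op_mx_unit : op_injective A -> op_mx \in unitmx.
Proof.
move=> inj; rewrite -row_free_unit; apply: inj_row_free => v v0.
rewrite -[v]wave_ofK; apply/rowP=> u; rewrite !mxE.
by apply: inj => s n; rewrite -wave_of_op_mx v0 /wave_of mxE.
Qed.

End Linear.

Lemma wave_of_inj v w : wave_of v = wave_of w -> v = w.
Proof. by move=> vw; rewrite -[v]wave_ofK vw wave_ofK. Qed.

Lemma rank_eigenspace_even (H : 'M[F]_#|{: state}|) (lambda : F) (h A B : wave -> wave) :
  (2 : F) != 0 ->
  (forall v s n, wave_of (v *m H) s n = h (wave_of v) s n) ->
  op_linear A -> op_linear B -> op_injective A -> op_injective B ->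
  (forall psi s n, A (h psi) s n = h (A psi) s n) ->
  (forall psi s n, B (h psi) s n = h (B psi) s n) ->
  (forall psi s n, A (B psi) s n = - B (A psi) s n) ->
  ~~ odd (\rank (eigenspace H lambda)).
Proof.
move=> two_neq0 hE linA linB injA injB Ah Bh AB.
have hW v : wave_of (v *m H) = h (wave_of v).
  by apply/funext=> s; apply/funext=> n.
have eq_mx (C D : 'M[F]_#|{: state}|) :
    (forall v, wave_of (v *m C) = wave_of (v *m D)) -> C = D.
  move=> CD; rewrite -[C]mul1mx -[D]mul1mx.
  by apply/row_matrixP=> u; rewrite !row_mul; apply: wave_of_inj.
apply: (@anticommuting_rank_even _ _ two_neq0 H (op_mx A) (op_mx B)).
- exact: op_mx_unit.
- exact: op_mx_unit.
- apply: eq_mx => v; rewrite !mulmxA ?hW ?(wave_of_op_mx linA, wave_of_op_mx linB) ?hW.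
  by apply/funext=> s; apply/funext=> n.
- apply: eq_mx => v; rewrite !mulmxA ?hW ?(wave_of_op_mx linA, wave_of_op_mx linB) ?hW.
  by apply/funext=> s; apply/funext=> n.
apply: eq_mx => v; rewrite mulmxN !mulmxA.
have -> w : wave_of (- w) = fun s n => - wave_of w s n.
  by apply/funext=> s; apply/funext=> n; rewrite /wave_of mxE.
rewrite ?(wave_of_op_mx linA, wave_of_op_mx linB); apply/funext=> s; apply/funext=> n.
by rewrite AB opprK.
Qed.

Lemma sum_agree i j s (G : conf -> F) : i != j ->
  \sum_t G t *+ agree_off i j s t = \sum_a \sum_b G (upd (upd s i a) j b).
Proof.
move=> ij; rewrite pair_big /=.
under eq_bigr do rewrite mulrb; rewrite -big_mkcond /=.
rewrite (reindex_onto (fun p => upd (upd s i p.1) j p.2) (fun t => (t i, t j))) /=.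
  apply: eq_bigl => -[a b] /=; rewrite upd_neq // !upd_eq eqxx andbT.
  by apply/forallP=> l; apply/implyP=> /andP[li lj]; rewrite !upd_neq.
move=> t /forallP st; apply/ffunP=> l; rewrite !ffunE.
case: eqP => [->//|/eqP lj]; case: eqP => [->//|/eqP li].
by apply/eqP; move/implyP: (st l); apply; rewrite li.
Qed.

Lemma wave_of_mul_tr (K : conf -> 'Z_N -> conf -> 'Z_N -> F) (H : 'M[F]_#|{: state}|) v s n :
  (forall u w, H u w = K (enum_val u).1 (enum_val u).2 (enum_val w).1 (enum_val w).2) ->
  wave_of (v *m H^T) s n = \sum_t \sum_m K s n t m * wave_of v t m.
Proof.
move=> HK; rewrite {1}/wave_of mxE.
rewrite -(sum_state (fun x => K s n x.1 x.2 * wave_of v x.1 x.2)).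
apply: eq_bigr => u _; rewrite mxE HK enum_rankK mulrC; congr (_ * _).
by rewrite /wave_of -surjective_pairing enum_valK.
Qed.

End Action.

(** * The Hamiltonian on wave functions *)

Section Ham.
Variables (R : realType) (N M L : nat).
Notation conf := {ffun 'Z_L -> 'I_2}.
Notation wave := (wave R[i] N L).
Notation wave_of_ := (@wave_of R[i] N L).
Implicit Types (v : 'rV[R[i]]_(hdim L N)) (i j : 'Z_L) (s : conf) (n : 'Z_N).
Let q := qpar R N M.

Lemma bond_entry (s1 s2 a b : 'I_2) :
  bond R N M (mxtens_index (s1, s2)) (mxtens_index (a, b)) = bond_coef q s1 s2 a b.
Proof.
rewrite /bond -/q !mxE !mxtens_indexK /=.
move: s1 s2 a b; do 4! apply: ord2P; rewrite /= ?(mulr1n, mulr0n) ; ring.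
Qed.

Lemma on_sites_act i j v s n : i != j ->
  wave_of_ (v *m (on_sites N i j (bond R N M))^T) s n =
  locb i j (bond_coef q) (wave_of_ v) s n.
Proof.
move=> ij.
rewrite (@wave_of_mul_tr _ _ _ (fun s n t m => bond_coef q (s i) (s j) (t i) (t j)
    *+ (agree_off i j s t && (n == m)))); last first.
  move=> u w; rewrite mxE; case: (enum_val u) => s' n'; case: (enum_val w) => t m.
  by rewrite bond_entry.
transitivity (\sum_(t : conf)
  (bond_coef q (s i) (s j) (t i) (t j) * wave_of_ v t n) *+ agree_off i j s t).
  apply: eq_bigr => t _; rewrite (bigD1 n) //= big1 ?addr0.
    by rewrite eqxx andbT mulrnAl.
  by move=> m mn; rewrite eq_sym (negPf mn) andbF mul0r.
rewrite sum_agree //; apply: eq_bigr => a _; apply: eq_bigr => b _.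
by rewrite upd_neq // !upd_eq.
Qed.

Lemma on_sites_end_act i j (A : 'M[R[i]]_(2 * 2 * edim N)) (K : kernel2 R[i] N) v s n : i != j ->
  (forall (s1 s2 a b : 'I_2) n m, A (basis3 s1 s2 n) (basis3 a b m) =
     K s1 s2 a b n *+ (m == shift (shift n s1 a) s2 b)) ->
  wave_of_ (v *m (on_sites_end i j A)^T) s n = loc2 i j K (wave_of_ v) s n.
Proof.
move=> ij AK.
rewrite (@wave_of_mul_tr _ _ _ (fun s n t m =>
   (K (s i) (s j) (t i) (t j) n *+ (m == shift (shift n (s i) (t i)) (s j) (t j)))
    *+ agree_off i j s t)); last first.
  move=> u w; rewrite mxE; case: (enum_val u) => s' n'; case: (enum_val w) => t m.
  by rewrite -AK.
transitivity (\sum_(t : conf) (K (s i) (s j) (t i) (t j) n *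
    wave_of_ v t (shift (shift n (s i) (t i)) (s j) (t j))) *+ agree_off i j s t).
  apply: eq_bigr => t _; rewrite (bigD1 (shift (shift n (s i) (t i)) (s j) (t j))) //= big1 ?addr0.
    by rewrite eqxx mulr1n mulrnAl.
  by move=> m /negPf mn; rewrite mn mulr0n mul0rn mul0r.
rewrite sum_agree //; apply: eq_bigr => a _; apply: eq_bigr => b _.
by rewrite upd_neq // !upd_eq.
Qed.

Lemma hamiltonian_act sigma (eta : 'Z_(2 * N)) (k : 'Z_L) (K : kernel2 R[i] N) v s n :
  (forall (s1 s2 a b : 'I_2) n m, seam_eta R M sigma eta (basis3 s1 s2 n) (basis3 a b m) =
     K s1 s2 a b n *+ (m == shift (shift n s1 a) s2 b)) ->
  wave_of_ (v *m (hamiltonian R M sigma eta k)^T) s n =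
  \sum_(j | j != k - 1) locb j (j + 1) (bond_coef q) (wave_of_ v) s n
  + loc2 (k - 1) k K (wave_of_ v) s n.
Proof.
move=> seamE; rewrite /hamiltonian linearD mulmxDr.
have wD (x y : 'rV[R[i]]_(hdim L N)) : wave_of_ (x + y) s n = wave_of_ x s n + wave_of_ y s n.
  by rewrite /wave_of mxE.
rewrite wD (on_sites_end_act _ _ _ (site_pred k) seamE); congr (_ + _).
rewrite linear_sum mulmx_sumr /wave_of summxE /=; apply: eq_bigr => j _.
by rewrite -on_sites_act // eq_sym site_succ.
Qed.

End Ham.

(** * The root of unity and the twisted seam *)

Section Eps.
Variables (R : realType) (N : nat).
Hypothesis N_gt0 : (0 < N)%N.

Lemma eps_exp (n : nat) :
  eps R N ^+ n = cos (pi / N%:R *+ n) +i* sin (pi / N%:R *+ n).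
Proof.
elim: n => [|n IH]; first by rewrite expr0 mulr0n cos0 sin0.
rewrite exprS IH mulrS cosD sinD /eps; simpc.
by congr (_ +i* _); rewrite addrC.
Qed.

Lemma eps_expN : eps R N ^+ N = -1.
Proof.
rewrite eps_exp -[_ *+ N]mulr_natr divfK ?pnatr_eq0 -?lt0n // cospi sinpi.
by apply/eqP; rewrite eq_complex /= oppr0 !eqxx.
Qed.

Lemma eps_neq0 : eps R N != 0.
Proof.
apply/eqP=> e0; have := eps_expN; rewrite e0 expr0n eqn0Ngt N_gt0 => /eqP.
by rewrite eq_sym oppr_eq0 oner_eq0.
Qed.

Lemma conjC_eps : Num.conj (eps R N) = (eps R N)^-1.
Proof.
apply: (mulfI eps_neq0); rewrite divff ?eps_neq0 //.
rewrite /eps /=; simpc.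
apply/eqP; rewrite eq_complex /= -!expr2 cos2Dsin2 eqxx.
by rewrite [sin _ * _]mulrC addNr eqxx.
Qed.

(** Raising to the power N sends eps to -1, which reveals the parity of the exponent. *)
Lemma eps_exp_odd (a b : nat) : eps R N ^+ a = eps R N ^+ b -> odd a = odd b.
Proof.
move=> /(congr1 (fun x => x ^+ N)); rewrite -!exprM ![(_ * N)%N]mulnC !exprM eps_expN.
rewrite -(signr_odd _ a) -(signr_odd _ b); case: (odd a); case: (odd b) => //= /eqP.
  by rewrite expr0 expr1 eq_sym -subr_eq0 opprK -mulr2n pnatr_eq0.
by rewrite expr0 expr1 -subr_eq0 opprK -mulr2n pnatr_eq0.
Qed.

Lemma eps_exp_mod (a b : nat) : a = b %[mod 2 * N] -> eps R N ^+ a = eps R N ^+ b.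
Proof.
have eps2N : eps R N ^+ (2 * N) = 1 by rewrite mulnC exprM eps_expN expr2 mulrNN mulr1.
by move=> ab; rewrite -(expr_mod a eps2N) ab expr_mod.
Qed.
End Eps.

(** Every nonzero entry contains x with exponent s2 - b, so conjugation by diag(1, f) on the second
    site replaces Z by f Z. *)
Lemma seam_coef_scale (F : fieldType) (q f x : F) (s1 s2 a b : nat) :
  f != 0 -> (s2 < 2)%N -> (b < 2)%N ->
  seam_coef q (f * x) s1 s2 a b = f ^+ s2 * seam_coef q x s1 s2 a b / f ^+ b.
Proof.
move=> f0 s2_lt b_lt; rewrite /seam_coef invfM.
(* With these inverses abstracted, f is the only denominator left for [field]. *)
move: (x^-1) (2^-1) (q^-1) (q ^- 3) (q ^- 2) => y z w w3 w2.
by case: s1 s2 s2_lt a b b_lt => [|[|s1]] [|[|//]] _ [|[|a]] [|[|//]] _;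
  rewrite ?expr0 ?expr1; field; rewrite ?f0 ?oner_neq0.
Qed.

Lemma conjC_exp (C : numClosedFieldType) (x : C) n :
  Num.conj (x ^+ n) = Num.conj x ^+ n.
Proof. exact: rmorphXn. Qed.

(** * Entries of the twisted seam *)

Section Seam.
Variables (R : realType) (N M : nat).
Hypothesis N_gt1 : (1 < N)%N.
Let q := qpar R N M.

Definition second_spin (u : 'I_(2 * 2 * edim N)) : 'I_2 :=
  (mxtens_unindex (mxtens_unindex u).1).2.

Lemma site_diag (F : 'M[R[i]]_2) : F 0 1 = 0 -> F 1 0 = 0 ->
  (1%:M *t F *t 1%:M : 'M_(2 * 2 * edim N)) =
  diag_mx (\row_u F (second_spin u) (second_spin u)).
Proof.
move=> F01 F10; apply/matrixP=> u w.
case: (mxtens_indexP u) => u12 u3; case: (mxtens_indexP w) => w12 w3.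
case: (mxtens_indexP u12) => u1 u2; case: (mxtens_indexP w12) => w1 w2.
rewrite !tensmxE !mxE /second_spin !mxtens_indexK /=.
rewrite !(can_eq (@mxtens_indexK _ _)) !xpair_eqE.
rewrite (can_eq (@mxtens_indexK _ _)) xpair_eqE.
case: (u1 == w1); case: (u3 == w3); rewrite /= ?(mulr0, mul0r, mul1r, mulr1, andbF, mulr0n) //.
rewrite andbT; move: u2 w2; do 2! apply: ord2P => //=; rewrite mulr0n.
  by rewrite -[RHS]F01; congr (F _ _); apply: val_inj.
by rewrite -[RHS]F10; congr (F _ _); apply: val_inj.
Qed.

Lemma adjoint_entry (C : numClosedFieldType) m n (A : 'M[C]_(m, n)) i j :
  (A ^t* )%sesqui i j = Num.conj (A j i).
Proof. by rewrite !mxE. Qed.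

Lemma diag_mul_diag_entry (A : pzRingType) n (d d' : 'rV[A]_n) (B : 'M_n) i j :
  (diag_mx d *m B *m diag_mx d') i j = d 0 i * B i j * d' 0 j.
Proof. by rewrite mul_mx_diag mxE mul_diag_mx mxE. Qed.

Lemma seam_eta_entry sigma (eta : 'Z_(2 * N)) (s1 s2 a b : 'I_2) (n m : 'Z_N) :
  seam_eta R M sigma eta (basis3 s1 s2 n) (basis3 a b m) =
  Fop R sigma eta s2 s2 * seam R N M sigma (basis3 s1 s2 n) (basis3 a b m) *
    Num.conj (Fop R sigma eta b b).
Proof.
have [F01 F10] : Fop R sigma eta 0 1 = 0 /\ Fop R sigma eta 1 0 = 0.
  by case: sigma; rewrite /Fop !mxE /= ?mulr0 addr0.
rewrite /seam_eta !site_diag //; last 2 first.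
- by rewrite [LHS]adjoint_entry F10 conjC0.
- by rewrite [LHS]adjoint_entry F01 conjC0.
rewrite [LHS]diag_mul_diag_entry [in LHS]mxE [in X in _ * X]mxE.
by rewrite [X in _ * X]adjoint_entry /second_spin !mxtens_indexK.
Qed.

Lemma qpar_neq0 : q != 0.
Proof. by rewrite expf_neq0 // eps_neq0 // ltnW. Qed.

Lemma fpar_neq0 (eta : 'Z_(2 * N)) : fpar R eta != 0.
Proof. by rewrite expf_neq0 // eps_neq0 // ltnW. Qed.

Lemma conjC_fpar (eta : 'Z_(2 * N)) : Num.conj (fpar R eta) = (fpar R eta)^-1.
Proof.
by rewrite /fpar [LHS]conjC_exp (conjC_eps R (ltnW N_gt1)) exprVn.
Qed.

Lemma seam_eta_plus (eta : 'Z_(2 * N)) (s1 s2 a b : 'I_2) (n m : 'Z_N) :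
  seam_eta R M Plus eta (basis3 s1 s2 n) (basis3 a b m) =
  seam_coef q (fpar R eta * q ^+ (2 * shift (shift n s1 a) s2 b)) s1 s2 a b
    *+ (m == shift (shift n s1 a) s2 b).
Proof.
have FE (x : 'I_2) : Fop R Plus eta x x = fpar R eta ^+ x.
  by rewrite /Fop !mxE; move: x; apply: ord2P; rewrite /= ?(mulr0, mulr1, addr0, add0r).
rewrite seam_eta_entry !FE [X in _ * X]conjC_exp conjC_fpar seam_plus_entry ?qpar_neq0 //.
have -> : (n == m + (s1%:R + s2%:R - a%:R - b%:R)) = (m == shift (shift n s1 a) s2 b).
  rewrite -subr_eq [RHS]eq_sym; congr (_ == _); rewrite /shift; ring.
case: eqP => [<-|_]; last by rewrite !mulr0n mulr0 mul0r.
by rewrite !mulr1n seam_coef_scale ?fpar_neq0 // exprVn.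
Qed.

(** Here F is diag(f, 1), which the spin flip turns into diag(1, f); hence f enters without
    inversion. *)
Lemma seam_eta_minus (eta : 'Z_(2 * N)) (s1 s2 a b : 'I_2) (n m : 'Z_N) :
  seam_eta R M Minus eta (basis3 s1 s2 n) (basis3 a b m) =
  seam_coef q^-1 (fpar R eta * q ^+ (2 * shift (shift n s1 a) s2 b))
      (rev_ord s1) (rev_ord s2) (rev_ord a) (rev_ord b)
    *+ (m == shift (shift n s1 a) s2 b).
Proof.
have FE (x : 'I_2) : Fop R Minus eta x x = fpar R eta ^+ rev_ord x.
  rewrite /Fop !mxE; move: x; apply: ord2P; rewrite !rev_ord2 /= ?(mulr0, mulr1, addr0, add0r) //.
rewrite seam_eta_entry !FE [X in _ * X]conjC_exp conjC_fpar seam_minus_entry ?qpar_neq0 //.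
have -> : (n == m + (s1%:R + s2%:R - a%:R - b%:R)) = (m == shift (shift n s1 a) s2 b).
  rewrite -subr_eq [RHS]eq_sym; congr (_ == _); rewrite /shift; ring.
case: eqP => [<-|_]; last by rewrite !mulr0n mulr0 mul0r.
by rewrite !mulr1n seam_coef_scale ?fpar_neq0 ?ltn_ord // exprVn.
Qed.
End Seam.

(** * Even degeneracy *)

Section Degeneracy.
Variables (F : fieldType) (N L : nat) (p f : F) (e : 'Z_N).
Hypotheses (two_neq0 : (2 : F) != 0) (N_gt1 : (1 < N)%N) (L_gt1 : (1 < L)%N).
Hypotheses (p_neq0 : p != 0) (f_neq0 : f != 0) (p2N : p ^+ (2 * N) = 1).
Notation wave := (wave F N L).
Implicit Types (psi : wave) (s : {ffun 'Z_L -> 'I_2}) (n : 'Z_N) (k : 'Z_L).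

(** The eigenvalue of zeta on |n> for p = q, and on |-n> for p = q^-1. *)
Definition end_phase n : F := f * p ^+ (2 * n).

Lemma pow_natr (m : nat) : p ^+ (2 * (m%:R : 'Z_N)) = p ^+ (2 * m).
Proof. by rewrite val_Zp_nat // !exprM expr_mod // -exprM. Qed.

Lemma pow_add (a b : 'Z_N) : p ^+ (2 * (a + b)%R) = p ^+ (2 * a) * p ^+ (2 * b).
Proof. by rewrite -{1}[a]natr_Zp -{1}[b]natr_Zp -natrD pow_natr mulnDr exprD. Qed.

Lemma pow_opp (a : 'Z_N) : p ^+ (2 * (- a)%R) = p ^- (2 * a).
Proof.
apply: (mulfI (expf_neq0 (2 * a) p_neq0)).
by rewrite -pow_add subrr mulfV ?expf_neq0.
Qed.

Lemma end_phase_neq0 n : end_phase n != 0.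
Proof. by rewrite mulf_neq0 ?expf_neq0. Qed.

Lemma end_phaseS n : end_phase (n + 1) = p ^+ 2 * end_phase n.
Proof. by rewrite /end_phase pow_add -[1]/(1%:R) pow_natr; ring. Qed.

Hypothesis f_square : f ^+ 2 = p ^+ (2 * e).
Hypothesis no_unit_monodromy : forall n, p ^+ (2 * L + 1) * end_phase n != 1.

(** Solves f^2 p^(2c) = p^-(2L+2), the condition on the reflection n -> c - n. *)
Let c : 'Z_N := - (e + L.+1%:R).

Lemma end_phaseC n : end_phase n * end_phase (c - n) = p ^- (2 * L + 2).
Proof.
have -> : (2 * L + 2 = 2 * L.+1)%N by rewrite mulnS addnC.
rewrite /end_phase mulrACA -expr2 f_square -!pow_add [n + _]addrC subrK /c.
by rewrite opprD addrA subrr sub0r pow_opp pow_natr.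
Qed.

Lemma ham_rank_even k (H : 'M[F]_#|{: {ffun 'Z_L -> 'I_2} * 'Z_N}|) lambda :
  (forall v s n, wave_of (v *m H) s n = ham p end_phase k (wave_of v) s n) ->
  ~~ odd (\rank (eigenspace H lambda)).
Proof.
move=> Hact; have nz := end_phase_neq0; have phS := end_phaseS; have phC := end_phaseC.
apply: (rank_eigenspace_even (h := ham p end_phase k)
  (A := charge_conj p c k) (B := dressed_transl p end_phase k) lambda two_neq0 Hact).
- exact: charge_conj_linear.
- exact: dressed_transl_linear.
- exact: charge_conj_injective.
- exact: dressed_transl_injective.
- move=> psi s n; exact: charge_conj_ham.
- move=> psi s n; exact: dressed_transl_ham.
move=> psi s n; exact: dressed_transl_charge_conj.
Qed.

Definition mirror psi : wave := fun s n => psi (flip s) (- n).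

Lemma mirrorK psi : mirror (mirror psi) = psi.
Proof.
by apply/funext=> s; apply/funext=> n; rewrite /mirror flipK opprK.
Qed.

(** Both symmetries are conjugated by the involution [mirror]. *)
Lemma mirrored_ham_rank_even k (H : 'M[F]_#|{: {ffun 'Z_L -> 'I_2} * 'Z_N}|) lambda :
  (forall v s n, wave_of (v *m H) s n =
     mirror (ham p end_phase k (mirror (wave_of v))) s n) ->
  ~~ odd (\rank (eigenspace H lambda)).
Proof.
move=> Hact; have nz := end_phase_neq0; have phS := end_phaseS; have phC := end_phaseC.
pose A psi := mirror (charge_conj p c k (mirror psi)).
pose B psi := mirror (dressed_transl p end_phase k (mirror psi)).
apply: (rank_eigenspace_even
  (h := fun psi => mirror (ham p end_phase k (mirror psi))) (A := A) (B := B) lambda two_neq0 Hact).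
- move=> a phi psi s n.
  exact: (charge_conj_linear p c k a (mirror phi) (mirror psi)).
- move=> a phi psi s n.
  exact: (dressed_transl_linear p end_phase k a (mirror phi) (mirror psi)).
- move=> psi psi0 s n; rewrite -[psi]mirrorK.
  apply: (@charge_conj_injective _ _ _ p c p_neq0 k (mirror psi)) => r m.
  by rewrite -(psi0 (flip r) (- m)) /A {2}/mirror flipK opprK.
- move=> psi psi0 s n; rewrite -[psi]mirrorK.
  apply: (@dressed_transl_injective _ _ _ _ _ two_neq0 p_neq0 nz
    no_unit_monodromy k (mirror psi)) => r m.
  by rewrite -(psi0 (flip r) (- m)) /B {2}/mirror flipK opprK.
- move=> psi s n; rewrite /A !mirrorK {1 3}/mirror.
  exact: charge_conj_ham.
- move=> psi s n; rewrite /B !mirrorK {1 3}/mirror.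
  exact: dressed_transl_ham.
move=> psi s n; rewrite /A /B !mirrorK {1 3}/mirror.
exact: dressed_transl_charge_conj.
Qed.

End Degeneracy.

(** * The reflection exchanging the two seams *)

Section Reflection.
Variables (F : fieldType) (N L : nat) (q f : F).
Hypotheses (N_gt1 : (1 < N)%N) (q_neq0 : q != 0) (q2N : q ^+ (2 * N) = 1).
Implicit Types (psi : wave F N L).

Lemma bond_coef_flip (s1 s2 a b : 'I_2) :
  bond_coef q^-1 (rev_ord s1) (rev_ord s2) (rev_ord a) (rev_ord b) =
  bond_coef q s1 s2 a b.
Proof.
by move: s1 s2 a b; do 4! apply: ord2P; rewrite !rev_ord2 /= ?invrK 1?[q^-1 + q]addrC.
Qed.

Lemma mirror_ham k psi s n :
  mirror (ham q^-1 (end_phase q^-1 f) k (mirror psi)) s n =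
  \sum_(j | j != k - 1) locb j (j + 1) (bond_coef q) psi s n
  + loc2 (k - 1) k (fun s1 s2 a b n =>
      seam_coef q^-1 (f * q ^+ (2 * shift (shift n s1 a) s2 b))
        (rev_ord s1) (rev_ord s2) (rev_ord a) (rev_ord b)) psi s n.
Proof.
have shift_opp m (a b : 'I_2) : shift (- m) (rev_ord a) (rev_ord b) = - shift m a b :> 'Z_N.
  by rewrite -[- m]sub0r shift_flip sub0r.
have oppE (m : 'Z_N) : q^-1 ^+ (2 * (- m)%R) = q ^+ (2 * m).
  by rewrite (pow_opp N_gt1) ?invr_eq0 // exprVn ?q2N ?invr1 ?invrK.
rewrite {1}/mirror /ham; congr (_ + _).
  apply: eq_bigr => j _; rewrite /locb (reindex_inj rev_ord_inj); apply: eq_bigr => a _.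
  rewrite (reindex_inj rev_ord_inj); apply: eq_bigr => b _ /=.
  by rewrite [flip s _]ffunE [flip s (j + 1)]ffunE bond_coef_flip !upd_flip /mirror flipK opprK.
rewrite /loc2 (reindex_inj rev_ord_inj); apply: eq_bigr => a _.
rewrite (reindex_inj rev_ord_inj); apply: eq_bigr => b _ /=.
rewrite [flip s (k - 1)]ffunE [flip s k]ffunE !upd_flip !shift_opp /mirror flipK opprK.
by rewrite /seamK !shift_opp /end_phase oppE.
Qed.

End Reflection.

(** * Parity and coprimality *)

Section RootsOfUnity.
Variables (R : realType) (N M : nat).
Hypotheses (N_gt1 : (1 < N)%N) (M_gt0 : (0 < M)%N) (MN : gcdn M N = 1%N).
Let q := qpar R N M.
Variable eta : 'Z_(2 * N).
Let f := fpar R eta.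

Lemma nu_odd : nu M eta = 1 -> odd (M + eta).
Proof.
rewrite /nu (_ : _ - _ = (M + eta)%:Z - 1); last by rewrite PoszD; ring.
rewrite exprzDr ?unitrN1 // -exprnP -signr_odd.
by case: odd.
Qed.

Lemma qpar_2N : q ^+ (2 * N) = 1.
Proof.
have eps2N : eps R N ^+ (2 * N) = 1.
  by rewrite mulnC exprM (eps_expN R (ltnW N_gt1)) expr2 mulrNN mulr1.
by rewrite /q /qpar -exprM mulnC exprM eps2N expr1n.
Qed.

(** From u M = v N + 1 follows eps^2 = q^(2u), so f^2 = q^(2 u eta). This provides the reflection
    centre c. *)
Lemma fpar_square : exists d : nat, f ^+ 2 = q ^+ (2 * d).
Proof.
have [u v uv _] := egcdnP N M_gt0; rewrite MN in uv.
exists (u * eta)%N; rewrite /f /fpar /q /qpar -!exprM.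
apply: eps_exp_mod => //; first exact: ltnW.
have -> : (M * (2 * (u * eta)) = 2 * (u * M) * eta)%N by ring.
rewrite uv; have -> : (2 * (v * N + 1) * eta = v * eta * (2 * N) + eta * 2)%N by ring.
by rewrite modnMDl.
Qed.
End RootsOfUnity.

(* eigenspace and eigenvalue refer to row vectors; for the operator H on     *)
(* column vectors, H *m v = lambda *: v is v^T *m H^T = lambda *: v^T.       *)
Theorem corollary5p5 (R : realType) (N M L : nat)
  (hN : (2 <= N)%N) (hM : (1 <= M < N)%N) (hMN : gcdn M N = 1%N)
  (hL : (3 <= L)%N) (sigma : seam_sign) (k : 'Z_L) (eta : 'Z_(2 * N))
  (hnu : nu M eta = 1) (lambda : R[i])
  (hlambda : eigenvalue (hamiltonian R M sigma eta k)^T lambda) :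
  ~~ odd (\rank (eigenspace (hamiltonian R M sigma eta k)^T lambda)).
Proof.
have odd_Meta := nu_odd hnu; have M_gt0 : (0 < M)%N by case/andP: hM.
have N_gt0 := ltnW hN; have L_gt1 := ltnW hL.
have two_neq0 : (2 : R[i]) != 0 by rewrite pnatr_eq0.
have q0 := qpar_neq0 R M hN; have f0 := fpar_neq0 R hN eta.
have q2N := qpar_2N R M hN; have [d fd] := fpar_square R hN M_gt0 hMN eta.
set q := qpar R N M in q0 q2N fd; set f := fpar R eta in f0 fd.
case: sigma hlambda => _.
  apply: (@ham_rank_even _ _ _ q f d%:R) => //.
  - by rewrite pow_natr.
  - move=> n; apply: contraTneq odd_Meta => gE.
    (* A value gamma = 1 would make eps^0 equal to a power of eps whose exponent has the parity of M
       + eta, which is odd. *)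
    suff /(eps_exp_odd N_gt0) : eps R N ^+ (M * (2 * L + 1) + (eta + M * (2 * n))) = eps R N ^+ 0.
      by rewrite !(oddD, oddM) /= andbT andbF addbF => ->.
    by rewrite !exprD [RHS]expr0 -gE /end_phase /q /qpar -!exprM.
  move=> v s n; exact: (hamiltonian_act k (K := seamK q (end_phase q f)) v s n
    (seam_eta_plus R M hN eta)).
have qV2N : q^-1 ^+ (2 * N) = 1 by rewrite exprVn q2N invr1.
have qV0 : q^-1 != 0 by rewrite invr_eq0.
(* f^2 = q^(2d) has to be a power of q^-1, hence the sign of [d]. *)
apply: (@mirrored_ham_rank_even _ _ _ q^-1 f (- d%:R)) => //.
- by rewrite pow_opp // pow_natr // exprVn invrK.
- move=> n; apply: contraTneq odd_Meta => gE.
  (* The negative powers of q are moved to the other side to keep exponents natural; eta and M would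
     then have equal parity. *)
  suff /(eps_exp_odd N_gt0) : eps R N ^+ eta = eps R N ^+ (M * (2 * L + 1 + 2 * n)).
    by rewrite oddD => ->; rewrite !(oddD, oddM) /= andbT addbb.
  rewrite exprM -/q exprD -[LHS]/f.
  apply: (mulIf (mulf_neq0 (expf_neq0 (2 * L + 1) qV0) (expf_neq0 (2 * n) qV0))).
  rewrite mulrACA -!exprMn mulfV // !expr1n mulr1 -gE /end_phase; ring.
move=> v s n; rewrite mirror_ham //.
apply: (hamiltonian_act k (K := fun s1 s2 a b n =>
  seam_coef q^-1 (f * q ^+ (2 * shift (shift n s1 a) s2 b))
    (rev_ord s1) (rev_ord s2) (rev_ord a) (rev_ord b)) v s n).
exact: (seam_eta_minus R M hN eta).
Qed.
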